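(* Let $n\ge 2$ be an integer and let $(X,d)$ be a complete metric space with $|X|\geq n$. Let $T\colon X\to X$ be an asymptotically regular $n$-point Kannan-type mapping with coefficient $\lambda\in[0,1)$, i.e. $S(Tx_1,\dots,Tx_n)\le\lambda\sum_{i=1}^n d(x_i,Tx_i)$ for all pairwise distinct points $x_1,\dots,x_n\in X$. Then $T$ has a fixed point in $X$. Moreover, $T$ can admit at most $n-1$ fixed points.
   Context: $|X|$ denotes the cardinality of $X$. For points $x_1,\dots,x_n$ of a metric space $(X,d)$ put $S(x_1,\dots,x_n)=\sum_{1\le i<j\le n} d(x_i,x_j)$. A mapping $T\colon X\to X$ is asymptotically regular if $\lim_{k\to\infty} d(T^{k}x,T^{k+1}x)=0$ for all $x\in X$. Here the coefficient $\lambda$ is allowed to range over $[0,1)$; $T$ is not assumed continuous. *)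

(* Defs.v *)
From HB Require Import structures.
From mathcomp Require Import all_boot all_order all_algebra.
From mathcomp Require Import all_classical all_reals all_analysis.
Import numFieldNormedType.Exports.

Set Implicit Arguments.
Unset Strict Implicit.
Unset Printing Implicit Defensive.

Import Order.TTheory GRing.Theory Num.Theory.
Local Open Scope classical_set_scope.
Local Open Scope ring_scope.

(* [Complete] also carries a distinguished point, so that complete metric
   spaces are nonempty here. *)
#[short(type="completeMetricType")]
HB.structure Definition CompleteMetric (R : numDomainType) :=
  {X of Complete X & Metric R X}.

Definition pairwise_dist_sum (R : realType) (X : metricType R) (n : nat)
    (x : 'I_n -> X) : R :=
  \sum_(i < n) \sum_(j < n | (i < j)%N) mdist (x i) (x j).

Definition asymptotically_regular (R : realType) (X : metricType R)
    (T : X -> X) : Prop :=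
  forall x : X, mdist (iter k T x) (iter k.+1 T x) @[k --> \oo] --> (0 : R).

Definition npoint_kannan_type (R : realType) (X : metricType R) (n : nat) (lambda : R)
    (T : X -> X) : Prop :=
  forall x : 'I_n -> X, injective x ->
    pairwise_dist_sum (T \o x) <= lambda * \sum_(i < n) mdist (x i) (T (x i)).

(* Main.v *)
Require Import Defs.
From HB Require Import structures.
From mathcomp Require Import all_boot all_order all_algebra.
From mathcomp Require Import all_classical all_reals all_analysis.
From mathcomp Require Import lra.
Import numFieldNormedType.Exports.
Import Order.TTheory GRing.Theory Num.Theory.
Local Open Scope classical_set_scope.
Local Open Scope card_scope.
Local Open Scope ring_scope.

(** Along an orbit without fixed points the iterates are pairwise distinct,
    since a repetition would make the steps [d(T^k x, T^(k+1) x)] periodic, hence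
    zero. The Kannan inequality for a point [a] off the tail of the orbit and
    [n - 1] consecutive iterates then bounds [d(T a, T^(N+1) x)] by
    [lambda (d(a, T a) + o(1))]. With [a] an iterate this makes the orbit Cauchy;
    with [a] its limit [p], it gives [d(T p, p) <= lambda d(p, T p)]. *)

(** Lets a cardinality bound be proved by refuting an injection of [n.+1] indices, with no prior
    finiteness of [A]. *)
Lemma card_le_II_or_gt (U : Type) (A : set U) (n : nat) :
  A #<= `I_n \/ `I_n.+1 #<= A.
Proof.
have [[k Ak]|/infiniteP Ainf] := pselect (finite_set A); last first.
  by right; apply: card_le_trans (card_leT _) Ainf.
rewrite (card_le_eql Ak) (card_le_eqr Ak) !card_le_II.
by have [kn|nk] := leqP k n; [left|right].
Qed.

Section NPointKannan.
Context {R : realType} {X : metricType R}.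
Implicit Types (T : X -> X) (a p x : X) (lambda : R).

Lemma pairwise_dist_sum_ge (n : nat) (y : 'I_n -> X) (i j : 'I_n) :
  (i < j)%N -> mdist (y i) (y j) <= pairwise_dist_sum y.
Proof.
move=> ij; rewrite /pairwise_dist_sum (bigD1 i)//= (bigD1 j)//= -addrA lerDl.
by rewrite addr_ge0 ?sumr_ge0// => k _; rewrite ?mdist_ge0 ?sumr_ge0// => l _;
  rewrite mdist_ge0.
Qed.

(** At [n.+2] distinct fixed points the right-hand side of the Kannan inequality vanishes, while the
    left one dominates the positive distance between two of them. *)
Lemma npoint_kannan_fixed_card T lambda (n : nat) :
  npoint_kannan_type n.+2 lambda T -> [set p | T p = p] #<= `I_n.+1.
Proof.
move=> hT; have [//|] := card_le_II_or_gt _ [set p | T p = p] n.+1.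
move=> /card_leP[f]; exfalso.
pose g (i : 'I_n.+2) : X := val (f (exist _ (val i) (mem_set (ltn_ord i)))).
have Tg i : T (g i) = g i by rewrite /g; case: (f _) => q /= /set_mem.
have ginj : injective g.
  move=> i j /val_inj/(@inj _ _ _ f) ij.
  have /(congr1 val) := ij (mem_set I) (mem_set I).
  by move=> /= ?; exact: val_inj.
have := hT g ginj; rewrite big1 ?mulr0 => [|i _]; last by rewrite Tg mdistxx.
apply/negP; rewrite -ltNge.
apply: (lt_le_trans _ (pairwise_dist_sum_ge _ (T \o g) ord0 (lift ord0 ord0) _)) => //.
rewrite /= !Tg mdist_gt0; apply/eqP => /ginj.
by move/eqP; rewrite (negbTE (neq_lift _ _)).
Qed.

Lemma iter_repeat_fixed T x (i p : nat) : asymptotically_regular T ->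
  (0 < p)%N -> iter (i + p) T x = iter i T x -> T (iter i T x) = iter i T x.
Proof.
move=> hreg p0 ip; apply/esym/mdist_positivity/eqP.
rewrite eq_le mdist_ge0 andbT; apply/ler_addgt0Pr => e e0; rewrite add0r.
have per m : iter (m * p) T (iter i T x) = iter i T x.
  by elim: m => // m IH; rewrite mulSn iterD IH -iterD addnC.
(* The index [N * p] is past [N] because [p] is positive, and by periodicity the step there equals
   the one at [i]. *)
have /cvgr0Pnorm_lt/(_ e e0)[N _ /(_ (N * p)%N)] := hreg (iter i T x).
rewrite /= per => /(_ (leq_pmulr _ p0)); rewrite ger0_norm ?mdist_ge0//.
by move/ltW.
Qed.

Lemma iter_injective T x : asymptotically_regular T ->
  (forall p, T p <> p) -> injective (fun k => iter k T x).
Proof.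
move=> hreg nfix.
suff lt i j : (i < j)%N -> iter i T x <> iter j T x.
  by move=> i j ij; case: (ltngtP i j) => // /lt; rewrite ij.
move=> ij eqij; apply: (nfix (iter i T x)).
apply: (iter_repeat_fixed _ _ _ (j - i)%N hreg); first by rewrite subn_gt0.
by rewrite subnKC// ltnW.
Qed.

Lemma npoint_kannan_iter T lambda (n N : nat) a x :
  npoint_kannan_type n.+2 lambda T -> injective (fun k => iter k T x) ->
  (forall k, (N <= k)%N -> iter k T x <> a) ->
  mdist (T a) (iter N.+1 T x) <= lambda * (mdist a (T a) +
    \sum_(k < n.+1) mdist (iter (k + N) T x) (iter (k + N).+1 T x)).
Proof.
move=> hT uinj aN.
(* Index 0 carries [a], index [k + 1] the iterate of order [k + N]; only the pair of indices 0 and 1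
   is kept from the sum on the left. *)
pose y (i : 'I_n.+2) :=
  if unlift ord0 i is Some k then iter (k + N) T x else a.
have yinj : injective y.
  move=> i j; rewrite /y; case: unliftP => [k ->|->]; case: unliftP => [l ->|->]//.
  - by move/uinj/addIn/val_inj ->.
  - by move/aN => /(_ (leq_addl _ _)).
  - by move/esym/aN => /(_ (leq_addl _ _)).
have := hT y yinj; rewrite big_ord_recl {2 3}/y unlift_none.
under eq_bigr do rewrite /y liftK.
apply: le_trans.
have := pairwise_dist_sum_ge _ (T \o y) ord0 (lift ord0 ord0) isT.
by rewrite /= /y unlift_none liftK.
Qed.

(** The number of summands is fixed, and each is a shift of a null sequence. *)
Lemma step_sum_cvg0 T (n : nat) x : asymptotically_regular T ->
  \sum_(k < n) mdist (iter (k + N) T x) (iter (k + N).+1 T x) @[N --> \oo]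
    --> (0 : R).
Proof.
move=> hreg; rewrite [X in _ --> X](_ : 0 = \sum_(k < n) 0 :> R);
  last by rewrite big1.
apply: cvg_big => [|k _]; first exact: add_continuous.
under eq_fun do rewrite addnC.
by have := hreg x; rewrite -(cvg_shiftn k).
Qed.

End NPointKannan.

Theorem theorem4p6 (R : realType) (n : nat) (hn : (2 <= n)%N)
    (X : completeMetricType R) (hX : `I_n #<= [set: X])
    (T : X -> X) (hreg : asymptotically_regular T)
    (lambda : R) (hlambda : 0 <= lambda < 1) (hT : npoint_kannan_type n lambda T) :
  (exists p : X, T p = p) /\ [set p : X | T p = p] #<= `I_n.-1.
Proof.
case: n hn hX hT => [|[|n]]// _ _ hT.
split; last exact: npoint_kannan_fixed_card hT.
apply: contrapT => nex.
have nfix p : T p <> p by move=> Tp; apply: nex; exists p.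
case/andP: hlambda => l0 l1.
pose u k := iter k T (point : X).
have uinj : injective u by exact: iter_injective.
pose S N := \sum_(k < n.+1) mdist (u (k + N)%N) (u (k + N).+1).
have S0 : S @ \oo --> (0 : R) by exact: step_sum_cvg0.
have S_ge0 N : 0 <= S N by rewrite sumr_ge0// => k _; exact: mdist_ge0.
(* Here [a] is [u i], which the tail from [j] avoids by injectivity; the factor [lambda] is bounded
   by 1. *)
have ustep i j : (i < j)%N ->
    mdist (u i.+1) (u j.+1) <= mdist (u i) (u i.+1) + S j.
  move=> ij; have off k : (j <= k)%N -> u k <> u i.
    by move=> jk /uinj ki; move: (leq_trans ij jk); rewrite ki ltnn.
  apply: le_trans (npoint_kannan_iter _ _ _ _ _ _ hT uinj off) _.
  exact: ler_piMl (addr_ge0 (mdist_ge0 _ _) (S_ge0 j)) (ltW l1).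
have ucvg : cvg (u @ \oo).
  apply/cauchy_cvgP/cauchy_exP => e e0.
  have e2 : 0 < e / 2 by rewrite divr_gt0.
  have /cvgr0Pnorm_lt/(_ _ e2)[N1 _ hN1] := hreg point.
  have /cvgr0Pnorm_lt/(_ _ e2)[N2 _ hN2] := S0.
  pose N := maxn N1 N2.
  (* Starting at [N.+2] makes every index a successor [j.+1] with [N < j], as [ustep] requires. *)
  exists (u N.+1); exists N.+2 => // -[//|j] /= Nj.
  rewrite ballEmdist.
  apply: le_lt_trans (ustep N j Nj) _; rewrite [e]splitr.
  apply: ltrD.
    by have := hN1 N (leq_maxl _ _); rewrite /= ger0_norm ?mdist_ge0.
  have := hN2 j (leq_trans (leq_maxr _ _) (ltnW Nj)).
  by rewrite /= ger0_norm.
pose p : X := lim (u @ \oo).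
(* The injective orbit meets its limit at most once. *)
have up_off : \forall N \near \oo, forall k, (N <= k)%N -> u k <> p.
  have [[m um]|nm] := pselect (exists m, u m = p).
    exists m.+1 => // N /= mN k Nk; rewrite -um => /uinj km.
    by move: (leq_trans mN Nk); rewrite km ltnn.
  by apply: nearW => N k _ uk; apply: nm; exists k.
apply: (nfix p); apply/mdist_positivity/eqP.
(* Strictness of [lambda < 1] enters here: it suffices that [(1 - lambda) * mdist (T p) p] is at
   most every positive [e]. *)
rewrite eq_le mdist_ge0 andbT -(pmulr_rle0 _ (_ : 0 < 1 - lambda)) ?subr_gt0//.
apply/ler_addgt0Pr => e e0; rewrite add0r.
have e2 : 0 < e / 2 by rewrite divr_gt0.
near \oo => N.
have SN : S N < e / 2.
  rewrite -(ger0_norm (S_ge0 N)); near: N.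
  by move/cvgr0Pnorm_lt: S0; apply.
have uN : mdist p (u N.+1) < e / 2.
  near: N; have up : (fun k => u k.+1) @ \oo --> p by rewrite (cvg_shiftS u).
  by apply: filterS (cvg_ball up e2) => k; rewrite ballEmdist.
have off : forall k, (N <= k)%N -> u k <> p by near: N.
have kan := npoint_kannan_iter _ _ _ _ _ _ hT uinj off.
have tri := metric_triangle (T p) (u N.+1) p.
have lS : lambda * S N <= S N by exact: ler_piMl (S_ge0 N) (ltW l1).
rewrite (metric_sym (u N.+1)) in tri.
rewrite -/(u N.+1) -/(S N) (metric_sym p) mulrDr in kan.
(* Adding [kan] and [tri] bounds this product by [lambda * S N + mdist p (u N.+1)], and each term is
   below [e / 2]. *)
rewrite mulrBl mul1r; move: kan tri lS uN SN; lra.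
Unshelve. all: by end_near.
Qed.
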